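(* Let $r:\mathbb{R}^n\to(0,\infty)$ be smooth with $|\nabla_{\mathbf y} r(\mathbf y)|<1$ for all $\mathbf y\in\mathbb{R}^n$. Let $\mathcal C$ be the canonical relation of the spherical Radon transform with radius function $r$, let $\Omega\subset\mathbb{R}^n$ be open, and let $$\mathcal C_\Omega=\{(\mathbf y,\eta;\mathbf x,\xi)\in\mathcal C:\ \mathbf x\in\Omega\}.$$ For $(\mathbf y,\eta)\in\Pi_L(\mathcal C)$ let $\lambda=(\mathbf y,\eta;\mathbf x,\xi)$ and $\hat\lambda=(\mathbf y,\eta;\hat{\mathbf x},\hat\xi)$ be its two preimages in $\mathcal C$ under $\Pi_L$. Then the restricted map $\Pi_L:\mathcal C_\Omega\to T^*(\mathbb{R}^n)$ is injective if and only if, for every $(\mathbf y,\eta)\in\Pi_L(\mathcal C)$, at most one of $\mathbf x$ and $\hat{\mathbf x}$ is in $\Omega$. In this case, $\mathcal C_\Omega$ satisfies the Bolker condition.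
   Context: $S(\mathbf y)=\{\mathbf x\in\mathbb{R}^n:|\mathbf x-\mathbf y|=r(\mathbf y)\}$, and $T^*(\mathbb{R}^n)$ is identified with $\mathbb{R}^n\times\mathbb{R}^n$. The canonical relation of $Rf(\mathbf y)=\int_{S(\mathbf y)}f\,dS$ is $$\mathcal C=\left\{\left(\mathbf y,-2\sigma r(\mathbf y)(\omega+\nabla_{\mathbf y} r(\mathbf y));\ \mathbf y+r(\mathbf y)\omega,-2\sigma r(\mathbf y)\omega\right):\ \mathbf y\in\mathbb{R}^n,\ \omega\in S^{n-1},\ \sigma\in\mathbb{R}\setminus\{0\}\right\},$$ and $\Pi_L(\mathbf y,\eta;\mathbf x,\xi)=(\mathbf y,\eta)$. When $|\nabla r|<1$ everywhere, each $(\mathbf y,\eta)\in\Pi_L(\mathcal C)$ has exactly two preimages in $\mathcal C$, $(\mathbf y,\eta;\mathbf x,\xi)$ and $(\mathbf y,\eta;\hat{\mathbf x},\hat\xi)$, where $\mathbf x$ and $\hat{\mathbf x}$ are the two points of intersection with $S(\mathbf y)$ of the line through $\mathbf x$ and $\mathbf y-r(\mathbf y)\nabla r(\mathbf y)$. The Bolker condition for $\mathcal C_\Omega$ means that $\Pi_L:\mathcal C_\Omega\to T^*(\mathbb{R}^n)$ is an embedding in the sense of an injective immersion. *)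

(* Defs.v *)
From HB Require Import structures.
From mathcomp Require Import all_boot all_order all_algebra.
From mathcomp Require Import all_classical all_reals all_analysis.

Set Implicit Arguments.
Unset Strict Implicit.
Unset Printing Implicit Defensive.

Import Order.TTheory GRing.Theory Num.Theory.
Import numFieldNormedType.Exports.

Local Open Scope classical_set_scope.
Local Open Scope ring_scope.

(* The norm `|x| that the library puts on row vectors is the sup norm; it
   induces the usual topology but is not the Euclidean length. *)
Definition enorm (R : realType) (n : nat) (x : 'rV[R]_n) : R :=
  Num.sqrt (\sum_(i < n) x ord0 i ^+ 2).

Definition grad (R : realType) (n : nat) (f : 'rV[R]_n -> R) (y : 'rV[R]_n) :
    'rV[R]_n :=
  \row_(i < n) 'D_(delta_mx ord0 i) f y.

(* C^oo: every iterated directional derivative of f (f itself for vs = [::])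
   is Frechet differentiable at every point. *)
Definition smooth (R : realType) (n : nat) (f : 'rV[R]_n -> R) : Prop :=
  forall (vs : seq 'rV[R]_n) (x : 'rV[R]_n),
    differentiable (foldr (fun v g => 'D_v g) f vs) x.

(* M is to be an embedded submanifold of V; the tangent space at p consists of
   the velocities at p of the curves in M. A curve that lies in M and is
   differentiable at 0 already has its velocity in the tangent space, so
   requiring more regularity would not change this set. *)
Definition tangent (R : realType) (V : normedModType R) (M : set V) (p : V) :
    set V :=
  [set v | exists g : R -> V,
     [/\ g 0 = p, \forall t \near (0 : R), M (g t) & is_derive (0 : R) 1 g v]].

(* f is given on the ambient space; the differential of its restriction to M is
   the restriction of 'd f p to the tangent space. *)
Definition immersion_on (R : realType) (V W : normedModType R) (M : set V)
    (f : V -> W) : Prop :=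
  forall p, M p ->
    differentiable f p /\
    (forall v, tangent M p v -> 'd f p v = 0 -> v = 0).

Definition sphere_at (R : realType) (n : nat) (r : 'rV[R]_n -> R)
    (y : 'rV[R]_n) : set 'rV[R]_n :=
  [set x | enorm (x - y) = r y].

Definition line (R : realType) (n : nat) (p q : 'rV[R]_n) : set 'rV[R]_n :=
  [set p + t *: (q - p) | t in [set: R]].

(* T^*(R^n) *)
Notation cotangent R n := ('rV[R]_n * 'rV[R]_n)%type.

Definition canonical_relation (R : realType) (n : nat) (r : 'rV[R]_n -> R) :
    set (cotangent R n * cotangent R n) :=
  [set l | exists (y omega : 'rV[R]_n) (sigma : R),
     [/\ enorm omega = 1, sigma != 0 &
         l = ((y, (- (2 * sigma * r y)) *: (omega + grad r y)),
              (y + r y *: omega, (- (2 * sigma * r y)) *: omega))]].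

Definition PiL (R : realType) (n : nat) (l : cotangent R n * cotangent R n) :
    cotangent R n :=
  l.1.

Definition base_x (R : realType) (n : nat)
    (l : cotangent R n * cotangent R n) : 'rV[R]_n :=
  l.2.1.

Definition canonical_relation_in (R : realType) (n : nat) (r : 'rV[R]_n -> R)
    (Omega : set 'rV[R]_n) : set (cotangent R n * cotangent R n) :=
  [set l | canonical_relation r l /\ Omega (base_x l)].

(* lam and lamh are the two preimages of (y, eta), and their x-components are
   the two points of S(y) on the line through x and y - r(y) grad r(y). *)
Definition two_preimages (R : realType) (n : nat) (r : 'rV[R]_n -> R)
    (ye : cotangent R n) (lam lamh : cotangent R n * cotangent R n) : Prop :=
  let y := ye.1 in
  [/\ base_x lam != base_x lamh,
      canonical_relation r `&` PiL (n := n) @^-1` [set ye] = [set lam; lamh] &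
      sphere_at r y `&` line (base_x lam) (y - r y *: grad r y) =
        [set base_x lam; base_x lamh]].

Definition bolker (R : realType) (n : nat)
    (C : set (cotangent R n * cotangent R n)) : Prop :=
  set_inj C (PiL (n := n)) /\ immersion_on C (PiL (n := n)).

(* Main.v *)
Require Import Defs.
From HB Require Import structures.
From mathcomp Require Import all_boot all_order all_algebra.
From mathcomp Require Import all_classical all_reals all_analysis.
From mathcomp Require Import ring lra.
Import Order.TTheory GRing.Theory Num.Theory.
Import numFieldNormedType.Exports.
Local Open Scope classical_set_scope.
Local Open Scope ring_scope.

(* Write g for the gradient of r at y. Points of C over the same (y, eta) have
   proportional vectors omega + g, so the others over the point given by omega
   come from unit vectors of the form c (omega + g) - g. As |g| < 1, the
   equation |c (omega + g) - g| = 1 has the two roots 1 and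
   -(1 - |g|^2) / |omega + g|^2 < 0; the same equation describes where the line
   through x and y - r g meets S(y).

   PiL is always an immersion: along a curve in C with y' = 0 and eta' = 0 one
   has eta = a (w + g) and xi = a w with |w| = 1, so a' (w + g) + a w' = 0 where
   w' is orthogonal to w. Pairing with w gives a' (1 + g.w) = 0, so a' = 0,
   w' = 0, and therefore x' = 0 and xi' = 0. *)

(** * The Euclidean inner product and norm on row vectors *)

Definition dotp {R : realType} {n : nat} (u v : 'rV[R]_n) : R :=
  \sum_(i < n) u ord0 i * v ord0 i.

Section EuclideanProduct.
Context {R : realType} {n : nat}.
Implicit Types (u v w : 'rV[R]_n) (a : R).

Lemma dotpC u v : dotp u v = dotp v u.
Proof. by apply: eq_bigr => i _; rewrite mulrC. Qed.

Lemma dotpDl u v w : dotp (u + v) w = dotp u w + dotp v w.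
Proof. by rewrite -big_split; apply: eq_bigr => i _; rewrite mxE mulrDl. Qed.

Lemma dotpZl a u v : dotp (a *: u) v = a * dotp u v.
Proof. by rewrite mulr_sumr; apply: eq_bigr => i _; rewrite mxE mulrA. Qed.

Lemma dotpDr u v w : dotp u (v + w) = dotp u v + dotp u w.
Proof. by rewrite dotpC dotpDl !(dotpC u). Qed.

Lemma dotpZr a u v : dotp u (a *: v) = a * dotp u v.
Proof. by rewrite dotpC dotpZl dotpC. Qed.

Lemma dotp_ge0 u : 0 <= dotp u u.
Proof. by apply: sumr_ge0 => i _; rewrite -expr2 sqr_ge0. Qed.

Lemma enormE u : enorm u = Num.sqrt (dotp u u).
Proof. by congr Num.sqrt; apply: eq_bigr => i _; rewrite expr2. Qed.

Lemma enorm_sqr u : enorm u ^+ 2 = dotp u u.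
Proof. by rewrite enormE sqr_sqrtr ?dotp_ge0. Qed.

Lemma enorm_ge0 u : 0 <= enorm u.
Proof. by rewrite enormE sqrtr_ge0. Qed.

Lemma enorm_eq1 u : enorm u = 1 <-> dotp u u = 1.
Proof.
by rewrite -enorm_sqr; split=> [->|/eqP];
  rewrite ?expr1n // sqrp_eq1 ?enorm_ge0 // => /eqP.
Qed.

Lemma enormZ a u : 0 <= a -> enorm (a *: u) = a * enorm u.
Proof.
move=> a0; rewrite !enormE dotpZl dotpZr mulrA -expr2.
by rewrite sqrtrM ?sqr_ge0 // sqrtr_sqr ger0_norm.
Qed.

End EuclideanProduct.

(** * The quadratic equation for the second unit vector *)

Section SecondIntersection.
Context {R : realType} {n : nat} {w g : 'rV[R]_n}.
Hypotheses (w1 : enorm w = 1) (g1 : enorm g < 1).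

Let ww : dotp w w = 1.
Proof. exact/enorm_eq1. Qed.

Let gg : dotp g g < 1.
Proof. by rewrite -enorm_sqr expr_lt1 ?enorm_ge0. Qed.

(** Expanding [|w + g|^2 >= 0] gives [2 (1 + g.w) >= 1 - |g|^2 > 0]. *)
Lemma dotp_unit_gtN1 : 0 < 1 + dotp g w.
Proof.
have := gg; have := dotp_ge0 (w + g).
rewrite dotpDl !dotpDr ww (dotpC w g); lra.
Qed.

(* The squared length of g - (g.w) w being nonnegative gives
   |w + g|^2 >= (1 + g.w)^2. *)
Lemma dotp_sum_gt0 : 0 < dotp (w + g) (w + g).
Proof.
have := dotp_unit_gtN1; have := dotp_ge0 (g + (- dotp g w) *: w).
rewrite !dotpDl !dotpDr !dotpZl !dotpZr ww (dotpC w g); nra.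
Qed.

(** The product of the roots of [|c (w + g) - g|^2 = 1] in [c], constant term over leading
    coefficient; as 1 is a root, this is the other one. *)
Definition second_scale : R := - (1 - dotp g g) / dotp (w + g) (w + g).

Lemma second_scale_lt0 : second_scale < 0.
Proof.
by rewrite /second_scale mulNr oppr_lt0 divr_gt0 ?dotp_sum_gt0 ?subr_gt0.
Qed.

Lemma enorm_scale_eq1 (c : R) :
  enorm (c *: (w + g) - g) = 1 <-> c = 1 \/ c = second_scale.
Proof.
have q0 : dotp (w + g) (w + g) != 0 by rewrite gt_eqF ?dotp_sum_gt0.
have E : dotp (c *: (w + g) - g) (c *: (w + g) - g) - 1 =
    (c - 1) * (c - second_scale) * dotp (w + g) (w + g).
  have sq : second_scale * dotp (w + g) (w + g) = - (1 - dotp g g).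
    by rewrite /second_scale divfK.
  (* Using [sq] removes the division, and [- g] becomes a multiple of [g] so that bilinearity
     expands both sides to polynomials. *)
  rewrite -mulrA [X in _ = _ * X]mulrBl sq -scaleN1r.
  rewrite !(dotpDl, dotpDr, dotpZl, dotpZr) ww (dotpC w g).
  ring.
rewrite enorm_eq1; split => [cc|].
  move: E; rewrite cc subrr => /esym/eqP.
  rewrite !mulf_eq0 (negbTE q0) orbF !subr_eq0.
  by case/orP => /eqP; [left|right].
by case=> cE; apply/eqP; rewrite -subr_eq0 E cE subrr ?mulr0 ?mul0r.
Qed.

End SecondIntersection.

(** * Differentiation along curves *)

Section Velocities.
Context {R : realType}.

Lemma is_derive_comp_diff (U V : normedModType R) (h : R -> U) (f : U -> V)
    (t : R) (u : U) :
  is_derive t 1 h u -> differentiable f (h t) ->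
  is_derive t 1 (f \o h) ('d f (h t) u).
Proof.
move=> [/derivable1_diffP dh hu] df.
apply: DeriveDef; first exact/derivable1_diffP/differentiable_comp.
rewrite deriveE; last exact: differentiable_comp.
by rewrite diff_comp //= -hu (deriveE _ dh).
Qed.

Lemma is_derive_comp_linear (U V : normedModType R) (h : R -> U)
    (f : {linear U -> V}) (t : R) (u : U) : continuous f ->
  is_derive t 1 h u -> is_derive t 1 (f \o h) (f u).
Proof.
move=> cf hu; rewrite -[in X in is_derive _ _ _ X](diff_lin (h t) cf).
exact/is_derive_comp_diff/linear_differentiable.
Qed.

Lemma is_derive_row (n : nat) (h : R -> 'rV[R]_n) (t : R) (u : 'rV[R]_n) :
  is_derive t 1 h u <->
  (forall i, is_derive t 1 (fun s => h s ord0 i) (u ord0 i)).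
Proof.
split=> [[dh <-] i|hu].
  rewrite derive_mx // mxE; apply: DeriveDef => //.
  exact: (derivable_mxP _ _ _).1 dh _ _.
have dh : derivable h t 1.
  by apply/derivable_mxP => i j; rewrite ord1; case: (hu j).
apply: DeriveDef => //; apply/rowP => i; rewrite derive_mx // mxE.
by case: (hu i).
Qed.

Lemma fst_continuous (U V : normedModType R) : continuous (@fst U V).
Proof. by move=> x; apply: cvg_fst. Qed.

Lemma snd_continuous (U V : normedModType R) : continuous (@snd U V).
Proof. by move=> x; apply: cvg_snd. Qed.

Lemma is_derive_fst (U V : normedModType R) (h : R -> U * V) (t : R) u :
  is_derive t 1 h u -> is_derive t 1 (fun s => (h s).1) u.1.
Proof. exact/is_derive_comp_linear/fst_continuous. Qed.

Lemma is_derive_snd (U V : normedModType R) (h : R -> U * V) (t : R) u :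
  is_derive t 1 h u -> is_derive t 1 (fun s => (h s).2) u.2.
Proof. exact/is_derive_comp_linear/snd_continuous. Qed.

Lemma is_derive_dotp (n : nat) (f g : R -> 'rV[R]_n) (t : R) u v :
  is_derive t 1 f u -> is_derive t 1 g v ->
  is_derive t 1 (fun s => dotp (f s) (g s)) (dotp (f t) v + dotp u (g t)).
Proof.
move=> /is_derive_row fu /is_derive_row gv.
have -> : (fun s => dotp (f s) (g s)) =
    \sum_(i < n) ((fun s => f s ord0 i) * (fun s => g s ord0 i)).
  by apply/funext => s; rewrite fct_sumE.
apply: is_derive_eq; rewrite /dotp -big_split.
by apply: eq_bigr => i _ /=; rewrite /GRing.scale /= (mulrC (u _ _)).
Qed.

Lemma is_derive_scale (n : nat) (a : R -> R) (f : R -> 'rV[R]_n) (t : R) b u :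
  is_derive t 1 a b -> is_derive t 1 f u ->
  is_derive t 1 (fun s => a s *: f s) (a t *: u + b *: f t).
Proof.
move=> ab /is_derive_row fu; apply/is_derive_row => i.
have -> : (fun s => (a s *: f s) ord0 i) = a * (fun s => f s ord0 i).
  by apply/funext => s; rewrite mxE.
by apply: is_derive_eq; rewrite !mxE /GRing.scale /= (mulrC b).
Qed.

(** Meant for functions of the base point [y] along a curve with [y' = 0]: the chain rule applies a
    linear map to a zero velocity. *)
Lemma is_derive_stationary (U V : normedModType R) (h : R -> U) (f : U -> V)
    (t : R) :
  is_derive t 1 h 0 -> differentiable f (h t) -> is_derive t 1 (f \o h) 0.
Proof.
move=> h0 df; rewrite -(linear0 ('d f (h t))).
exact: is_derive_comp_diff.
Qed.

End Velocities.

(** * The immersion property *)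

Lemma immersion_canonical_relation (R : realType) (n : nat) (r : 'rV[R]_n -> R)
    (Omega : set 'rV[R]_n) :
  (forall y, 0 < r y) -> smooth r -> (forall y, enorm (grad r y) < 1) ->
  immersion_on (canonical_relation_in r Omega) (PiL (n := n)).
Proof.
move=> r_gt0 r_smooth grad_lt1 p _.
have r_neq0 z : r z != 0 by rewrite gt_eqF.
have -> : @PiL R n = fst by [].
split; first exact/linear_differentiable/fst_continuous.
move=> v [h [h0 hC hv]].
rewrite diff_lin; last exact: fst_continuous.
move=> v10.
have /= hy := is_derive_fst _ _ _ _ _ (is_derive_fst _ _ _ _ _ hv).
have /= heta := is_derive_snd _ _ _ _ _ (is_derive_fst _ _ _ _ _ hv).
have /= hx := is_derive_fst _ _ _ _ _ (is_derive_snd _ _ _ _ _ hv).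
have /= hxi := is_derive_snd _ _ _ _ _ (is_derive_snd _ _ _ _ _ hv).
rewrite v10 /= in hy heta.
set y := (fun s => (h s).1.1) in hy; set eta := (fun s => (h s).1.2) in heta.
set x := (fun s => (h s).2.1) in hx; set xi := (fun s => (h s).2.2) in hxi.
(* [r] and the components of its gradient are iterated derivatives of order 0 and 1, so [smooth]
   makes them differentiable and they are stationary along with [y]. *)
have hr : is_derive (0 : R) 1 (r \o y) 0.
  exact/is_derive_stationary/(r_smooth [::]).
have hg : is_derive (0 : R) 1 (fun s => grad r (y s)) 0.
  apply/is_derive_row => i; rewrite mxE.
  have -> : (fun s => grad r (y s) ord0 i) = 'D_(delta_mx ord0 i) r \o y.
    by apply/funext => s; rewrite /= mxE.
  exact/is_derive_stationary/(r_smooth [:: _]).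
(* The curve is parametrised by y, w = (x - y) / r and a = xi . w, which
   inherit differentiability from its four components. *)
pose w s := (r (y s))^-1 *: (x s - y s).
pose a s := dotp (xi s) (w s).
have hw : is_derive (0 : R) 1 w ((r (y 0))^-1 *: v.2.1).
  have hV : is_derive (0 : R) 1 (fun s => (r (y s))^-1) 0.
    apply: (is_derive_eq (is_deriveV _ hr)); last by rewrite scaler0.
    exact: r_neq0.
  have := is_derive_scale _ _ _ _ _ _ hV (is_deriveB hx hy).
  by rewrite scale0r addr0 subr0.
have [b ha] : exists b, is_derive (0 : R) 1 a b.
  by eexists; exact: is_derive_dotp hxi hw.
(* The parameters witnessing membership in the relation are chosen separately for each [s];
   identifying them with [w s] and [a s] allows the relations to be differentiated at 0. *)
have near_rel : \forall s \near (0 : R), [/\ dotp (w s) (w s) = 1,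
    a s != 0, eta s = a s *: (w s + grad r (y s)) & xi s = a s *: w s].
  near=> s.
  have [[z [om [sg [om1 sg0 hs]]]] _] : canonical_relation_in r Omega (h s).
    by near: s.
  have ws : w s = om.
    by rewrite /w /x /y hs /= addrC addKr scalerA mulVf ?scale1r //.
  have oo : dotp om om = 1 by apply/enorm_eq1.
  have as_ : a s = - (2 * sg * r z).
    by rewrite /a ws /xi hs /= dotpZl oo mulr1.
  rewrite as_ ws /eta /xi /y hs; split=> //=.
  by rewrite oppr_eq0 !mulf_neq0 // ?pnatr_eq0.
have [ww a0 _ _] := nbhs_singleton near_rel.
(* The derivative of [|w|^2] is computed twice: as that of a locally constant function and by the
   product rule. *)
have ww' : dotp (w 0) ((r (y 0))^-1 *: v.2.1) = 0.
  have h1 : is_derive (0 : R) 1 (fun s => dotp (w s) (w s)) 0.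
    apply: near_eq_is_derive (is_derive_cst (1 : R) (0 : R) 1).
    by apply: filterS near_rel => s [-> _ _ _].
  have [_] := is_derive_dotp _ _ _ _ _ _ hw hw.
  have [_ ->] := h1.
  rewrite (dotpC _ (w 0)); lra.
(* The velocity of [w] gets a name; [w'E] later turns its vanishing into that of [x']. *)
move w'E : (_ *: v.2.1) hw ww' => w' hw ww'.
have heta' : a 0 *: w' + b *: (w 0 + grad r (y 0)) = 0.
  have [_ <-] := heta.
  have [_ etaE] := is_derive_scale _ _ _ _ _ _ ha (is_deriveD hw hg).
  rewrite addr0 in etaE; rewrite -etaE.
  by apply: near_eq_derive; apply: filterS near_rel => s [_ _ -> _].
have hxi' : v.2.2 = a 0 *: w' + b *: w 0.
  have [_ <-] := hxi.
  have [_ <-] := is_derive_scale _ _ _ _ _ _ ha hw.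
  by apply: near_eq_derive; apply: filterS near_rel => s [_ _ _ ->].
have b0 : b = 0.
  have w1 : enorm (w 0) = 1 by apply/enorm_eq1.
  have := congr1 (dotp (w 0)) heta'.
  rewrite dotpDr (dotpZr (a 0)) (dotpZr b) dotpDr ww' ww mulr0 add0r.
  rewrite (dotpC _ (grad _ _)).
  have -> : dotp (w 0) 0 = 0 by rewrite -(scale0r (w 0)) (dotpZr 0) mul0r.
  move/eqP; rewrite mulf_eq0 (gt_eqF (dotp_unit_gtN1 w1 (grad_lt1 (y 0)))) orbF.
  by move/eqP.
have w'0 : w' = 0.
  move/eqP: heta'; rewrite b0 scale0r addr0 scaler_eq0 (negbTE a0).
  by move/eqP.
have x0 : v.2.1 = 0.
  move/eqP: w'E; rewrite w'0 scaler_eq0 invr_eq0 (negbTE (r_neq0 _)).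
  by move/eqP.
move: v10 x0 hxi'; rewrite b0 w'0 scaler0 scale0r addr0.
by case: (v) => [v1 [v3 v4]] /= -> -> ->.
Unshelve. all: by end_near.
Qed.

(** * The two points of the relation over one covector *)

Definition relation_point {R : realType} {n : nat} (r : 'rV[R]_n -> R)
    (y w : 'rV[R]_n) (s : R) : cotangent R n * cotangent R n :=
  ((y, (- (2 * s * r y)) *: (w + grad r y)),
   (y + r y *: w, (- (2 * s * r y)) *: w)).

Section TwoPreimages.
Context {R : realType} {n : nat} {r : 'rV[R]_n -> R} {y w : 'rV[R]_n} {s : R}.
Hypotheses (ry_gt0 : 0 < r y) (grad_lt1 : enorm (grad r y) < 1).
Hypotheses (w1 : enorm w = 1) (s0 : s != 0).

Let g := grad r y.
Let c := second_scale (w := w) (g := g).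
Let w' := c *: (w + g) - g.

Let c_neq0 : c != 0.
Proof. by rewrite lt_eqF // second_scale_lt0. Qed.

Let w'1 : enorm w' = 1.
Proof. by apply/enorm_scale_eq1 => //; right. Qed.

(** [w - w' = (1 - c) (w + g)], where [c < 0] and [w + g] has positive length. *)
Let w'_neq : y + r y *: w != y + r y *: w'.
Proof.
rewrite (inj_eq (addrI y)) (inj_eq (scalerI _)) ?gt_eqF // -subr_eq0 /w'.
have -> : w - (c *: (w + g) - g) = (1 - c) *: (w + g).
  by rewrite scalerBl scale1r opprB addrA addrAC.
have c1 : 1 - c != 0.
  by rewrite gt_eqF // subr_gt0 (lt_trans (second_scale_lt0 _ _)).
rewrite scaler_eq0 (negbTE c1); apply/eqP => wg.
have := dotp_sum_gt0 w1 grad_lt1.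
by rewrite wg -(scale0r w) dotpZl mul0r ltxx.
Qed.

(** Since [w' + g = c (w + g)], replacing [s] by [s / c] leaves the covector unchanged. *)
Lemma two_preimages_relation_point :
  two_preimages r (PiL (relation_point r y w s))
    (relation_point r y w s) (relation_point r y w' (s / c)).
Proof.
have ry0 : r y != 0 by rewrite gt_eqF.
(* With [k = 1 - t] the line consists of the points with direction [k (w + g) - g], so it meets the
   sphere at the roots of the same quadratic: [t = 0] and [t = 1 - c]. *)
have lineE t : y + r y *: w + t *: (y - r y *: g - (y + r y *: w)) =
    y + r y *: ((1 - t) *: (w + g) - g).
  apply/rowP => i; rewrite !mxE; ring.
have sphereE k : sphere_at r y (y + r y *: (k *: (w + g) - g)) <->
    k = 1 \/ k = c.
  rewrite -(enorm_scale_eq1 w1 grad_lt1) /sphere_at /= addrC addKr.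
  rewrite enormZ ?ltW //; split=> [kE|->]; last by rewrite mulr1.
  by apply: (mulfI ry0); rewrite kE mulr1.
have xE : y + r y *: w = y + r y *: (1 *: (w + g) - g).
  by rewrite scale1r addrK.
split=> //; apply/seteqP; split=> [l|l].
- move=> [[z [om [sg [om1 sg0 ->]]]]]; rewrite /preimage /= => -[-> etaE].
  (* Cancelling [- 2 r(y)] yields [om = (s / sg) (w + g) - g]; as [om] is a unit vector, [s / sg] is
     1 or [c]. *)
  have {etaE} : sg *: (om + g) = s *: (w + g).
    apply: (@scalerI _ _ (- (2 * r y))).
      by rewrite oppr_eq0 mulf_neq0 ?pnatr_eq0.
    by rewrite !scalerA !mulNr !(mulrAC 2 (r y)).
  move=> /(congr1 (fun u => sg^-1 *: u)).
  rewrite !scalerA mulVf // scale1r mulrC => omE.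
  have {}omE : om = (s / sg) *: (w + g) - g by rewrite -omE addrK.
  have := om1; rewrite omE => /(enorm_scale_eq1 w1 grad_lt1).
  case=> sE; [left|right]; rewrite sE.
    have -> : sg = s by rewrite -[RHS](divfK sg0) sE mul1r.
    by rewrite scale1r addrK.
  have -> : sg = s / c by rewrite /c /g -sE invf_div mulrCA divff ?mulr1.
  by [].
- case=> ->; rewrite /preimage /=; split => //; first by exists y, w, s.
  + by exists y, w', (s / c); split=> //; rewrite mulf_neq0 ?invr_eq0.
  + congr pair; rewrite /w' subrK scalerA; congr (_ *: _).
    by field.
- move=> [] + [t _ lt]; rewrite -lt lineE => /sphereE[->|->]; last by right.
  by left; rewrite -xE.
- case=> ->; rewrite /base_x /=; split.
  + by rewrite xE; apply/sphereE; left.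
  + by exists 0 => //; rewrite scale0r addr0.
  + by apply/sphereE; right.
  + by exists (1 - c) => //; rewrite lineE subKr.
Qed.

End TwoPreimages.

(** * Injectivity and the Bolker condition *)

Theorem theorem3p6 (R : realType) (n : nat) (r : 'rV[R]_n -> R)
    (r_gt0 : forall y, 0 < r y)
    (r_smooth : smooth r)
    (grad_lt1 : forall y, enorm (grad r y) < 1)
    (Omega : set 'rV[R]_n) (Omega_open : open Omega) :
  [/\ (* every point of the image has its two preimages lam, lamh *)
      forall ye, (PiL (n := n) @` canonical_relation r) ye ->
        exists lam lamh, two_preimages r ye lam lamh,
      set_inj (canonical_relation_in r Omega) (PiL (n := n)) <->
        (forall ye, (PiL (n := n) @` canonical_relation r) ye ->
           forall lam lamh, two_preimages r ye lam lamh ->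
             ~ (Omega (base_x lam) /\ Omega (base_x lamh))) &
      set_inj (canonical_relation_in r Omega) (PiL (n := n)) ->
        bolker (canonical_relation_in r Omega)].
Proof.
have two ye : (PiL (n := n) @` canonical_relation r) ye ->
    exists lam lamh, two_preimages r ye lam lamh.
  move=> [_ [y [w [s [w1 s0 ->]]]] <-].
  do 2 eexists.
  exact: two_preimages_relation_point (r_gt0 y) (grad_lt1 y) w1 s0.
split=> //; last by split=> //; exact: immersion_canonical_relation.
split=> [inj ye _ lam lamh [neq fibre _] [Olam Olamh]|sep].
  have [Clam lamE] : (canonical_relation r `&` PiL (n := n) @^-1` [set ye]) lam.
    by rewrite fibre; left.
  have [Clamh lamhE] :
      (canonical_relation r `&` PiL (n := n) @^-1` [set ye]) lamh.
    by rewrite fibre; right.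
  (* [lam] and [lamh] now both lie in the restricted relation over [ye], so injectivity would merge
     their distinct base points. *)
  move/eqP: neq; apply; congr base_x.
  by apply: inj; rewrite ?inE //= lamE lamhE.
move=> l1 l2 /set_mem[C1 O1] /set_mem[C2 O2] l12.
have imye : (PiL (n := n) @` canonical_relation r) (PiL l1) by exists l1.
have [lam [lamh lamP]] := two _ imye.
have /not_andP sepl := sep _ imye _ _ lamP.
have [_ fibre _] := lamP.
(* Both points lie in the same two-element fibre; if they differed, they would be [lam] and [lamh]
   in some order, with both base points in [Omega]. *)
have : [set lam; lamh] l1 by rewrite -fibre.
have : [set lam; lamh] l2 by rewrite -fibre; split.
by case=> e2 [] e1; rewrite ?e1 ?e2 //; case: sepl; rewrite -?e1 -?e2.
Qed.
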